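(* Let $\mathfrak{L}$ be a Leibniz algebra over a field $\mathbb{F}$ admitting a multiplicative basis $\mathcal{B}=\{v_i\}_{i\in I}$, let $\Gamma(\mathfrak{L},\mathcal{B})=(V,E)$ be its associated directed graph, and let $\sim$ be the connectedness relation on $V=\mathcal{B}$. Then $\mathfrak{L}$ decomposes as the orthogonal direct sum $$\mathfrak{L}=\bigoplus_{[v_i]\in V/\sim}\mathfrak{L}_{C_{[v_i]}},$$ where each $\mathfrak{L}_{C_{[v_i]}}:=\bigoplus_{v_j\in[v_i]}\mathbb{F}v_j$ is an ideal of $\mathfrak{L}$ admitting the set $[v_i]\subset\mathcal{B}$ as a multiplicative basis.
   Context: A Leibniz algebra $\mathfrak{L}$ over an arbitrary field $\mathbb{F}$ is a vector space (of arbitrary dimension) with a bilinear product $[\cdot,\cdot]$ satisfying $[[y,z],x]=[[y,x],z]+[y,[z,x]]$ for all $x,y,z\in\mathfrak{L}$. An ideal of $\mathfrak{L}$ is a subspace $S$ (in particular a subalgebra) with $[S,\mathfrak{L}]+[\mathfrak{L},S]\subset S$. Let $\mathfrak{I}$ be the ideal generated by $\{[x,x]:x\in\mathfrak{L}\}$; it satisfies $[\mathfrak{L},\mathfrak{I}]=0$. Write $\mathfrak{L}=\mathfrak{I}\oplus\mathfrak{V}$ with $\mathfrak{V}$ a linear complement of $\mathfrak{I}$. Multiplicative basis: a basis $\mathcal{B}=\mathcal{B}_{\mathfrak{I}}\,\dot\cup\,\mathcal{B}_{\mathfrak{V}}$ of $\mathfrak{L}$, where $\mathcal{B}_{\mathfrak{I}}=\{e_k\}_{k\in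 K}$ is a basis of $\mathfrak{I}$ and $\mathcal{B}_{\mathfrak{V}}=\{u_j\}_{j\in J}$ is a basis of $\mathfrak{V}$, is called multiplicative if (i) for any $k\in K$, $j\in J$ we have $[e_k,u_j]\in\mathbb{F}e_i$ for some $i\in K$; and (ii) for any $j,k\in J$ either $[u_j,u_k]\in\mathbb{F}u_l$ for some $l\in J$, or $[u_j,u_k]\in\mathbb{F}e_i$ for some $i\in K$. (This is the form taken, because $[\mathfrak{L},\mathfrak{I}]=0$, by the general condition that for any two basis elements $v,v'$ one has $[v,v']\in\mathbb{F}v''$ for some basis element $v''$.) Associated graph: $\Gamma(\mathfrak{L},\mathcal{B})=(V,E)$ is the directed graph with $V=\mathcal{B}$ and $E=\{(v_j,v_k)\in V\times V:\{[v_i,v_j],[v_j,v_i]\}\cap\mathbb{F}^{\times}v_k\neq\emptyset\text{ for some }v_i\in\mathcal{B}\}$, where $\mathbb{F}^\times=\mathbb{F}\setminus\{0\}$. Connectedness: $v_i\sim v_j$ iff $v_i=v_j$ or there is an undirected path from $v_i$ to $v_j$, i.e. a finite sequence of vertices starting at $v_i$ and ending at $v_j$ in which any two consecutive vertices $v,v'$ satisfy $(v,v')\in E$ or $(v',v)\in E$. The equivalence class of $v_i$ is denoted $[v_i]$ and corresponds to the connected component $C_{[v_i]}$. Orthogonal: a direct sum of linear subspaces $\mathfrak{L}=\bigoplus_{j}\mathfrak{L}_j$ is orthogonal if $[\mathfrak{L}_j,\mathfrak{L}_k]=\{0\}$ for all $j\neq k$. *)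

(* Defs.v *)
From HB Require Import structures.
From mathcomp Require Import all_boot all_order all_algebra finmap.
From mathcomp Require Import boolp classical_sets.

Set Implicit Arguments.
Unset Strict Implicit.
Unset Printing Implicit Defensive.

Import GRing.Theory.

Local Open Scope classical_set_scope.
Local Open Scope ring_scope.

HB.mixin Record Lmodule_isLeibnizAlgebra (F : fieldType) L
    of GRing.Lmodule F L := {
  bracket : L -> L -> L;
  bracket_linearl : forall y, linear (bracket^~ y);
  bracket_linearr : forall x, linear (bracket x);
  bracket_leibniz : forall x y z,
    bracket (bracket y z) x = bracket (bracket y x) z + bracket y (bracket z x)
}.

#[short(type="leibnizAlgType")]
HB.structure Definition LeibnizAlgebra (F : fieldType) :=
  {L of GRing.Lmodule F L & Lmodule_isLeibnizAlgebra F L}.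

Section LinearAlgebra.
Context {F : fieldType} {L : lmodType F}.

Definition is_subspace (S : set L) : Prop := GRing.submod_closed [in S].

Definition line (v : L) : set L := [set a *: v | a in [set: F]].

Definition nz_line (v : L) : set L := [set a *: v | a in [set a : F | a != 0]].

(* The sum of the subspaces W i for i in D, where D may be infinite. *)
Definition subspace_sum {I : choiceType} (D : set I) (W : I -> set L) : set L :=
  [set x | exists (A : {fset I}) (f : I -> L),
    [/\ [set` A] `<=` D, forall i, i \in A -> W i (f i)
      & x = \sum_(i <- A) f i]].

Definition is_independent {I : choiceType} (D : set I) (W : I -> set L) : Prop :=
  forall (A : {fset I}) (f : I -> L),
    [set` A] `<=` D -> (forall i, i \in A -> W i (f i)) ->
    \sum_(i <- A) f i = 0 -> forall i, i \in A -> f i = 0.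

Definition is_direct_sum {I : choiceType} (S : set L) (D : set I)
    (W : I -> set L) : Prop :=
  S = subspace_sum D W /\ is_independent D W.

Definition is_complement (S I V : set L) : Prop :=
  [/\ is_subspace V, S = [set x + y | x in I & y in V] & I `&` V = [set 0]].

Definition is_free (B : set L) : Prop :=
  forall (A : {fset L}) (c : L -> F), [set` A] `<=` B ->
    \sum_(v <- A) c v *: v = 0 -> forall v, v \in A -> c v = 0.

Definition is_basis (S B : set L) : Prop :=
  is_free B /\ S = subspace_sum B line.

End LinearAlgebra.

(* The notions below are relative to a subalgebra S of the ambient algebra L,  *)
(* so that they apply both to L itself (S := setT) and to an ideal of L viewed *)
(* as a Leibniz algebra in its own right.                                      *)
Section Leibniz.
Context {F : fieldType} {L : leibnizAlgType F}.
Implicit Types (S B C : set L) (v w : L).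

Definition is_ideal S (I : set L) : Prop :=
  [/\ is_subspace I, I `<=` S
    & forall x y, I x -> S y -> I (bracket x y) /\ I (bracket y x)].

Definition leib_ideal S : set L :=
  smallest (is_ideal S) [set bracket x x | x in S].

(* Only the products [BI, BV] and [BV, BV] are constrained, since             *)
(* [S, leib_ideal S] = 0 follows from the Leibniz identity.                   *)
Definition is_multiplicative_basis S B : Prop :=
  is_basis S B /\
  exists V BI BV : set L,
    [/\ is_complement S (leib_ideal S) V,
        B = BI `|` BV /\ BI `&` BV = set0,
        is_basis (leib_ideal S) BI /\ is_basis V BV,
        forall e u, BI e -> BV u -> exists2 e', BI e' & line e' (bracket e u)
      & forall u u', BV u -> BV u' ->
          (exists2 w, BV w & line w (bracket u u')) \/
          (exists2 e, BI e & line e (bracket u u'))].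

(* Edges of the directed graph Gamma(L, B), whose vertex set is B. *)
Definition edge B v w : Prop :=
  [/\ B v, B w & exists2 u, B u &
    nz_line w (bracket u v) \/ nz_line w (bracket v u)].

Definition adjacent B : rel L := fun v w => `[< edge B v w \/ edge B w v >].

Definition connected B v w : Prop :=
  v = w \/ exists2 p : seq L, path (adjacent B) v p & last v p = w.

Definition component B v : set L := [set w | B w /\ connected B v w].

(* The quotient of B by the connectedness relation. *)
Definition components B : set (set L) := [set component B v | v in B].

Definition component_space C : set L := subspace_sum C line.

Definition orthogonal_family {I : Type} (D : set I) (W : I -> set L) : Prop :=
  forall i j, D i -> D j -> i <> j ->
    forall x y, W i x -> W j y -> bracket x y = 0.

End Leibniz.

(* Main.v *)
Require Import Defs.
From HB Require Import structures.
From mathcomp Require Import all_boot all_order all_algebra finmap.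
From mathcomp Require Import boolp classical_sets.

(* A nonzero product [v, w] of basis elements is a multiple of a basis        *)
(* element u that is adjacent to both v and w. Hence each component spans an  *)
(* ideal and distinct components are orthogonal. For the restricted basis to  *)
(* be multiplicative, the ideal I(L_C) generated by the squares of L_C must   *)
(* be spanned by the elements of B_I in C, where B_I is the given basis of    *)
(* the ideal I(L) generated by all squares. By orthogonality the direct sum   *)
(* of the I(L_C) is an ideal containing all squares, so I(L_C) is the         *)
(* intersection of I(L) and L_C, which is spanned by the elements of B_I in C *)
(* because B is free.                                                         *)

Set Implicit Arguments.
Unset Strict Implicit.
Unset Printing Implicit Defensive.

Import GRing.Theory.

Local Open Scope classical_set_scope.
Local Open Scope ring_scope.

(** The graph statement rests on [bracket_leib_ideal]: products whose right factor lies in the ideal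
    of squares vanish, so a product of two basis elements is zero or a nonzero multiple of a basis
    element u ([mult_basis_product]), and u is then joined to both factors ([nz_product_connected]).
    Bilinearity carries this from basis elements to spans, giving [component_space_ideal] and
    [orthogonal_components]; directness comes from freeness of B through [component_rest_eq0]. The
    delicate point is that [leib_ideal (component_space C)] is generated inside the component, so it
    could a priori be smaller than the trace of [leib_ideal [set: L]]. Orthogonality rules this out
    ([leib_ideal_sub_sum], [leib_ideal_component]), and [span_setI] then identifies its basis. *)

Notation span D := (subspace_sum D line).

(** * Subspaces, sums of families and spans *)

Section Subspaces.
Context {F : fieldType} {L : lmodType F}.
Implicit Types (S B D E : set L) (a : F) (x y v : L).

Lemma is_subspaceP S :
  is_subspace S <-> S 0 /\ forall a x y, S x -> S y -> S (a *: x + y).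
Proof.
split=> [[S0 Sl]|[S0 Sl]].
  split=> [|a x y Sx Sy]; first by move: S0; rewrite inE.
  by have := Sl a x y; rewrite !inE; apply.
by split=> [|a x y]; rewrite !inE //; apply: Sl.
Qed.

Lemma subspace0 S : is_subspace S -> S 0.
Proof. by move=> /is_subspaceP []. Qed.

Lemma subspaceD S x y : is_subspace S -> S x -> S y -> S (x + y).
Proof.
by move=> /is_subspaceP [_ Sl] Sx Sy; rewrite -[x]scale1r; apply: Sl.
Qed.

Lemma subspaceZ S a x : is_subspace S -> S x -> S (a *: x).
Proof.
by move=> /is_subspaceP [S0 Sl] Sx; rewrite -[_ *: _]addr0; apply: Sl.
Qed.

Lemma subspaceB S x y : is_subspace S -> S x -> S y -> S (x - y).
Proof.
by move=> Ss Sx Sy; apply: subspaceD => //; rewrite -scaleN1r; apply: subspaceZ.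
Qed.

Lemma subspace_big S (I : choiceType) (A : {fset I}) (P : pred I) (f : I -> L) :
  is_subspace S -> (forall i, i \in A -> P i -> S (f i)) ->
  S (\sum_(i <- A | P i) f i).
Proof.
move=> Ss Sf; rewrite big_seq_cond; apply: big_ind => [|x y|i /andP[iA Pi]].
- exact: subspace0.
- exact: subspaceD.
- exact: Sf.
Qed.

Lemma line_subspace v : is_subspace (line v).
Proof.
apply/is_subspaceP; split=> [|a _ _ [b _ <-] [c _ <-]].
  by exists 0 => //; rewrite scale0r.
by exists (a * b + c) => //; rewrite scalerDl scalerA.
Qed.

Lemma line_id v : line v v.
Proof. by exists 1 => //; rewrite scale1r. Qed.

Lemma line_sub S v : is_subspace S -> S v -> line v `<=` S.
Proof. by move=> Ss Sv _ [a _ <-]; apply: subspaceZ. Qed.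

Section Sums.
Context {I : choiceType}.
Implicit Types (X : set I) (W : I -> set L).

(** Padding by zero brings two finite sums to a common index set, where they can be added or
    compared. *)
Lemma sum_fset_extend0 (A A' : {fset I}) (f : I -> L) : (A `<=` A')%fset ->
  \sum_(i <- A) f i = \sum_(i <- A') (if i \in A then f i else 0).
Proof.
move=> AA'; rewrite -(big_fset_incl _ AA') => [|i _ /negPf -> //].
by apply: eq_big_seq => i ->.
Qed.

Lemma subspace_sum_subspace X W :
  (forall i, X i -> is_subspace (W i)) -> is_subspace (subspace_sum X W).
Proof.
move=> Ws; apply/is_subspaceP; split.
  by exists fset0, (fun=> 0); split=> //; rewrite big_seq_fset0.
move=> a _ _ [A [f [AX fW ->]]] [A' [f' [AX' fW' ->]]].
rewrite (sum_fset_extend0 f (fsubsetUl A A')).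
rewrite (sum_fset_extend0 f' (fsubsetUr A A')).
rewrite scaler_sumr -big_split /=.
have UX : [set` (A `|` A')%fset] `<=` X.
  by move=> i /=; rewrite in_fsetU => /orP[/AX|/AX'].
eexists _, _; split; [exact: UX| |by []].
move=> i iU /=; have Wi := Ws i (UX i iU).
apply: subspaceD => //; first apply: subspaceZ => //.
  by case: ifP => // [/fW|_] //; apply: subspace0.
by case: ifP => // [/fW'|_] //; apply: subspace0.
Qed.

Lemma subspace_sum_term X W i x : X i -> W i x -> subspace_sum X W x.
Proof.
move=> Xi Wx; exists [fset i]%fset, (fun=> x); split.
- by move=> j /=; rewrite in_fset1 => /eqP ->.
- by move=> j; rewrite in_fset1 => /eqP ->.
- by rewrite big_seq_fset1.
Qed.

Lemma subspace_sum_min X W S :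
  is_subspace S -> (forall i, X i -> W i `<=` S) -> subspace_sum X W `<=` S.
Proof.
move=> Ss WS x [A [f [AX fW ->]]]; apply: subspace_big => // i iA _.
exact: (WS i (AX i iA)) (fW i iA).
Qed.

Lemma subspace_sum_mono X Y W W' :
  X `<=` Y -> (forall i, X i -> W i `<=` W' i) ->
  subspace_sum X W `<=` subspace_sum Y W'.
Proof.
move=> XY WW' x [A [f [AX fW ->]]]; exists A, f; split=> //.
  by move=> i /AX /XY.
by move=> i iA; apply: (WW' i (AX i iA)) (fW i iA).
Qed.

Lemma subspace_sum_split X W i x :
  is_subspace (W i) -> subspace_sum X W x ->
  exists y z, [/\ W i y, subspace_sum (X `\ i) W z & x = y + z].
Proof.
move=> Wi [A [f [AX fW ->]]].
have rest : subspace_sum (X `\ i) W (\sum_(j <- A `\ i) f j)%fset.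
  exists (A `\ i)%fset, f; split=> // j /=; rewrite in_fsetD1 => /andP[ji jA].
    by split; [apply: AX | apply/eqP].
  exact: fW.
have [iA|iA] := boolP (i \in A).
  exists (f i), (\sum_(j <- A `\ i) f j)%fset; split=> //; first exact: fW.
  by rewrite (big_fsetD1 i).
exists 0, (\sum_(j <- A `\ i) f j)%fset; split=> //; first exact: subspace0.
by rewrite add0r mem_fsetD1.
Qed.

(** Subtracting the two expressions of x gives a vanishing sum over the union of their supports. The
    supports are disjoint, so its term at an index of the first is f i, which independence makes
    zero. *)
Lemma subspace_sum_disjoint X Y Z W x : is_independent X W ->
  (forall i, X i -> is_subspace (W i)) -> Y `<=` X -> Z `<=` X ->
  Y `&` Z = set0 -> subspace_sum Y W x -> subspace_sum Z W x -> x = 0.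
Proof.
move=> Xi Ws YX ZX YZ [A [f [AY fW xA]]] [A' [g [AZ gW xA']]].
have UX : [set` (A `|` A')%fset] `<=` X.
  by move=> i /=; rewrite in_fsetU => /orP[/AY/YX|/AZ/ZX].
rewrite xA; apply: big1_seq => i /andP[_ iA].
have iA' : i \in A' = false.
  apply/negP => iA'; suff : set0 i by [].
  by rewrite -YZ; split; [apply: AY|apply: AZ].
pose h j := (if j \in A then f j else 0) - (if j \in A' then g j else 0).
have := Xi _ h UX _ _ i; rewrite /h iA iA' subr0; apply.
- move=> j jU; have Wj := Ws j (UX j jU); apply: subspaceB => //.
    by case: ifP => // [/fW|_] //; apply: subspace0.
  by case: ifP => // [/gW|_] //; apply: subspace0.
- rewrite sumrB -(sum_fset_extend0 f (fsubsetUl A A')).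
  by rewrite -(sum_fset_extend0 g (fsubsetUr A A')) -xA -xA' subrr.
- by rewrite in_fsetU iA.
Qed.

End Sums.

(** * Spans of sets of vectors *)

Lemma span_subspace D : is_subspace (span D).
Proof. by apply: subspace_sum_subspace => v _; apply: line_subspace. Qed.

Lemma mem_span D v : D v -> span D v.
Proof. by move=> Dv; apply: subspace_sum_term Dv (line_id v). Qed.

Lemma span_min D S : is_subspace S -> D `<=` S -> span D `<=` S.
Proof.
by move=> Ss DS; apply: subspace_sum_min => // v Dv; apply: line_sub (DS v Dv).
Qed.

Lemma span_mono D E : D `<=` E -> span D `<=` span E.
Proof. by move=> DE; apply: subspace_sum_mono => // v _ x. Qed.

Lemma sumset_subspace S S' :
  is_subspace S -> is_subspace S' ->
  is_subspace [set x + y | x in S & y in S'].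
Proof.
move=> Ss Ss'; apply/is_subspaceP; split.
  by exists 0; [exact: subspace0|exists 0; [exact: subspace0|rewrite addr0]].
move=> a _ _ [x Sx [y Sy <-]] [x' Sx' [y' Sy' <-]].
exists (a *: x + x'); first by apply: subspaceD => //; apply: subspaceZ.
exists (a *: y + y'); first by apply: subspaceD => //; apply: subspaceZ.
by rewrite scalerDr addrACA.
Qed.

Lemma span_setU D E :
  span (D `|` E) = [set x + y | x in span D & y in span E].
Proof.
apply/seteqP; split.
  apply: span_min; first by apply: sumset_subspace; apply: span_subspace.
  move=> v [Dv|Ev]; [exists v|exists 0].
  - exact: mem_span.
  - by exists 0; [exact: subspace0 (span_subspace E)|rewrite addr0].
  - exact: subspace0 (span_subspace D).
  - by exists v; [exact: mem_span|rewrite add0r].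
move=> _ [x Dx [y Ey <-]]; apply: subspaceD; first exact: span_subspace.
  by apply: span_mono Dx => v; left.
by apply: span_mono Ey => v; right.
Qed.

Lemma free_independent B : is_free B -> is_independent B line.
Proof.
move=> Bf A f AB fl s0 v vA.
have /choice[c cE] (w : L) : exists a, w \in A -> f w = a *: w.
  have [wA|_] := boolP (w \in A); last by exists 0.
  by have [a _ <-] := fl w wA; exists a.
rewrite cE // (Bf A c AB _ v vA) ?scale0r // -[RHS]s0.
by apply: eq_big_seq => w /cE.
Qed.

Lemma span_disjoint B D E x : is_free B -> D `<=` B -> E `<=` B ->
  D `&` E = set0 -> span D x -> span E x -> x = 0.
Proof.
move=> /free_independent Bi; apply: (subspace_sum_disjoint Bi) => v _.
exact: line_subspace.
Qed.

(** Write x in the span of D as y + z, with y supported on D meet E and z on D minus E. If x is also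
    in the span of E then so is z = x - y, and disjointness of supports forces z = 0. *)
Lemma span_setI B D E : is_free B -> D `<=` B -> E `<=` B ->
  span D `&` span E = span (D `&` E).
Proof.
move=> Bf DB EB; apply/seteqP; split=> [x [Dx Ex]|x DEx]; last first.
  by split; apply: span_mono DEx => v [].
have := Dx; rewrite -{1}(setUIDK D E) span_setU => -[y DEy [z DEz yz]].
suff z0 : z = 0 by rewrite -yz z0 addr0.
apply: (span_disjoint Bf (_ : D `\` E `<=` B) EB _ DEz).
- by move=> v [/DB].
- by apply/seteqP; split=> // v [[]].
- rewrite -(addKr y z) yz addrC; apply: subspaceB => //.
    exact: span_subspace.
  by apply: span_mono DEy => v [].
Qed.

End Subspaces.

(** * Brackets, ideals and the ideal of squares *)

Section Brackets.
Context {F : fieldType} {L : leibnizAlgType F}.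
Implicit Types (S I B C D E : set L) (u v w x y z : L).

Lemma set0_subspace : is_subspace [set 0 : L].
Proof.
by apply/is_subspaceP; split=> // a _ _ -> ->; rewrite scaler0 addr0.
Qed.

Lemma bracketDl x x' y : bracket (x + x') y = bracket x y + bracket x' y.
Proof. by have := bracket_linearl y 1 x x'; rewrite !scale1r. Qed.

Lemma bracketDr x y y' : bracket x (y + y') = bracket x y + bracket x y'.
Proof. by have := bracket_linearr x 1 y y'; rewrite !scale1r. Qed.

Lemma bracket0l y : bracket 0 y = 0.
Proof. by apply: (addrI (bracket 0 y)); rewrite -bracketDl !addr0. Qed.

Lemma bracket0r x : bracket x 0 = 0.
Proof. by apply: (addrI (bracket x 0)); rewrite -bracketDr !addr0. Qed.

Lemma bracket_suml (T : Type) (r : seq T) (f : T -> L) y :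
  bracket (\sum_(i <- r) f i) y = \sum_(i <- r) bracket (f i) y.
Proof.
exact: (big_morph (fun x => bracket x y) (fun x x' => bracketDl x x' y)
  (bracket0l y)).
Qed.

Lemma bracket_sumr (T : Type) (r : seq T) (f : T -> L) x :
  bracket x (\sum_(i <- r) f i) = \sum_(i <- r) bracket x (f i).
Proof. exact: (big_morph (bracket x) (bracketDr x) (bracket0r x)). Qed.

(** With its mirror image below, this puts bilinearity in the form that [span_min] and
    [subspace_sum_min] consume: a claim about products need only be checked on generators. *)
Lemma bracket_preiml_subspace S y :
  is_subspace S -> is_subspace [set x | S (bracket x y)].
Proof.
move=> Ss; apply/is_subspaceP; split=> [|a x x' Sx Sx'] /=.
  by rewrite bracket0l; apply: subspace0.
by rewrite bracket_linearl; apply: subspaceD => //; apply: subspaceZ.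
Qed.

Lemma bracket_preimr_subspace S x :
  is_subspace S -> is_subspace [set y | S (bracket x y)].
Proof.
move=> Ss; apply/is_subspaceP; split=> [|a y y' Sy Sy'] /=.
  by rewrite bracket0r; apply: subspace0.
by rewrite bracket_linearr; apply: subspaceD => //; apply: subspaceZ.
Qed.

Lemma bracket_span S D E : is_subspace S ->
  (forall v w, D v -> E w -> S (bracket v w)) ->
  forall x y, span D x -> span E y -> S (bracket x y).
Proof.
move=> Ss DES x y Dx; apply: (span_min (bracket_preimr_subspace x Ss)).
move=> w Ew /=; apply: (span_min (bracket_preiml_subspace w Ss)) Dx.
by move=> v Dv; apply: DES.
Qed.

Lemma bracket_span0 D E : (forall v w, D v -> E w -> bracket v w = 0) ->
  forall x y, span D x -> span E y -> bracket x y = 0.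
Proof. exact: bracket_span set0_subspace. Qed.

Lemma leib_ideal_sq S x : S x -> leib_ideal S (bracket x x).
Proof. by move=> Sx; apply: sub_gen_smallest; exists x. Qed.

(** An intersection of ideals is an ideal; the hypothesis puts S itself among the ideals being
    intersected, which keeps the result inside S. *)
Lemma is_ideal_leib_ideal S : is_ideal S S -> is_ideal S (leib_ideal S).
Proof.
move=> SS; split.
- apply/is_subspaceP; split=> [|a x y Ix Iy] I [Ii SI].
    by case: Ii => Is _ _; apply: subspace0.
  case: (Ii) => Is _ _; apply: subspaceD => //; first apply: subspaceZ => //.
    exact: Ix.
  exact: Iy.
- apply: smallest_sub => // _ [x Sx <-].
  by case: SS => _ _ SS; case: (SS x x Sx Sx).
- move=> x y Ix Sy; split=> I [Ii SI]; case: (Ii) => _ _ Ib.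
    by case: (Ib x y (Ix I (conj Ii SI)) Sy).
  by case: (Ib x y (Ix I (conj Ii SI)) Sy).
Qed.

Lemma is_ideal_setT : is_ideal [set: L] [set: L].
Proof. by split=> //; apply/is_subspaceP. Qed.

(** The elements that annihilate L as right factors form an ideal Z containing every square: the
    Leibniz identity for [[w,z],z] cancels to [w,[z,z]] = 0. For z in Z, it also gives [v,[z,w]] =
    [[v,z],w] - [[v,w],z] = 0. *)
Lemma bracket_leib_ideal x y : leib_ideal [set: L] y -> bracket x y = 0.
Proof.
pose Z := [set y | forall x, bracket x y = 0].
suff IZ : leib_ideal [set: L] `<=` Z by move=> /IZ; apply.
apply: smallest_sub; last first.
  move=> _ [z _ <-] w; apply: (addrI (bracket (bracket w z) z)).
  by rewrite addr0 -bracket_leibniz.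
split=> //.
  apply/is_subspaceP; split=> [w|a z z' Zz Zz' w]; first exact: bracket0r.
  by rewrite bracket_linearr Zz Zz' scaler0 addr0.
move=> z w Zz _; split=> v; last by rewrite Zz bracket0r.
by have := bracket_leibniz w v z; rewrite !Zz bracket0l add0r => <-.
Qed.

Lemma nz_lineP v x : line v x -> x = 0 \/ nz_line v x.
Proof.
move=> [a _ <-]; have [->|a0] := eqVneq a 0; first by left; rewrite scale0r.
by right; exists a.
Qed.

Lemma nz_line_line v x : nz_line v x -> line v x.
Proof. by move=> [a _ <-]; exists a. Qed.

(** * Connectedness in the graph *)

Section Components.
Context {B : set L}.

Lemma adjacent_sym : symmetric (adjacent B).
Proof.
move=> v w; apply: asbool_equiv_eq.
by split=> -[]; [right|left|right|left].
Qed.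

Lemma connectedP v w :
  connected B v w <-> exists2 p, path (adjacent B) v p & last v p = w.
Proof. by split=> [[->|//]|]; [exists [::]|right]. Qed.

Lemma connected_sym v w : connected B v w -> connected B w v.
Proof.
move=> /connectedP [p pp <-]; apply/connectedP.
exists (rev (belast v p)).
  rewrite rev_path (eq_path (e' := adjacent B)) // => x y.
  exact: adjacent_sym.
by case: p {pp} => //= u p; rewrite rev_cons last_rcons.
Qed.

Lemma connected_trans u v w :
  connected B u v -> connected B v w -> connected B u w.
Proof.
move=> /connectedP [p pp <-] /connectedP [q qq <-]; apply/connectedP.
by exists (p ++ q); rewrite ?cat_path ?pp ?last_cat.
Qed.

Lemma edge_connected v w : edge B v w -> connected B v w.
Proof.
move=> vw; right; exists [:: w] => //=; rewrite andbT.
by apply/asboolP; left.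
Qed.

Lemma component_eq v w : connected B v w -> component B v = component B w.
Proof.
move=> vw; apply/seteqP; split=> u [Bu cu]; split=> //.
  exact: connected_trans (connected_sym vw) cu.
exact: connected_trans cu.
Qed.

Lemma components_sub C : components B C -> C `<=` B.
Proof. by move=> [v _ <-] w []. Qed.

Lemma components_eq C C' v w : components B C -> components B C' ->
  C v -> C' w -> connected B v w -> C = C'.
Proof.
move=> [u _ <-] [u' _ <-] [_ uv] [_ uw] vw.
by rewrite (component_eq uv) (component_eq uw) (component_eq vw).
Qed.

Lemma components_connected C v w :
  components B C -> C v -> B w -> connected B v w -> C w.
Proof.
by move=> [u _ <-] [_ uv] Bw vw; split=> //; apply: connected_trans vw.
Qed.

Lemma components_cover v : B v -> exists2 C, components B C & C v.
Proof.
move=> Bv; exists (component B v); first by exists v.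
by split=> //; left.
Qed.

(** Each factor is the auxiliary vertex witnessing the edge from the other factor to u. *)
Lemma nz_product_connected v w u : B v -> B w -> B u ->
  nz_line u (bracket v w) -> connected B v u /\ connected B w u.
Proof.
move=> Bv Bw Bu vwu; split; apply: edge_connected; split=> //.
  by exists w => //; right.
by exists v => //; left.
Qed.

End Components.

(** * Components of a multiplicative basis: ideals, orthogonality, direct sum *)

Section MultiplicativeBasis.
Context {B : set L} (hB : is_multiplicative_basis [set: L] B).

Let Bfree : is_free B.
Proof. by case: hB => -[]. Qed.

Lemma mult_basis_product v w : B v -> B w ->
  bracket v w = 0 \/ exists2 u, B u & nz_line u (bracket v w).
Proof.
case: hB => _ [V [BI [BV [_ [BE _] [[_ IE] _] hIV hVV]]]].
have lineP u x : B u -> line u x -> x = 0 \/ exists2 u, B u & nz_line u x.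
  by move=> Bu /nz_lineP[->|ux]; [left|right; exists u].
rewrite {1 2}BE => Bv -[Iw|Vw].
  by left; apply: bracket_leib_ideal; rewrite IE; apply: mem_span.
case: Bv => [Iv|Vv].
  by have [u Iu] := hIV v w Iv Vw; apply: lineP; rewrite BE; left.
have [[u Vu]|[u Iu]] := hVV v w Vv Vw; apply: lineP; rewrite BE.
  by right.
by left.
Qed.

Lemma component_bracket C v w : components B C -> C v -> B w ->
  (bracket v w = 0 \/ exists2 u, C u & nz_line u (bracket v w)) /\
  (bracket w v = 0 \/ exists2 u, C u & nz_line u (bracket w v)).
Proof.
move=> hC Cv Bw; have Bv := components_sub hC Cv; split.
  have [->|[u Bu vwu]] := mult_basis_product Bv Bw; [by left|right].
  have [vu _] := nz_product_connected Bv Bw Bu vwu.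
  by exists u => //; apply: components_connected vu.
have [->|[u Bu vwu]] := mult_basis_product Bw Bv; [by left|right].
have [_ vu] := nz_product_connected Bw Bv Bu vwu.
by exists u => //; apply: components_connected vu.
Qed.

(** A nonzero product would be a multiple of a basis element joined to both v and w, which would put
    w in C. *)
Lemma component_orthogonal C v w :
  components B C -> C v -> (B `\` C) w -> bracket v w = 0 /\ bracket w v = 0.
Proof.
move=> hC Cv [Bw nCw]; have Bv := components_sub hC Cv.
have sep u : connected B w u -> connected B v u -> False.
  move=> wu vu; apply: nCw; apply: (components_connected hC Cv Bw).
  exact: connected_trans vu (connected_sym wu).
split.
  have [//|[u Bu vwu]] := mult_basis_product Bv Bw.
  by have [vu wu] := nz_product_connected Bv Bw Bu vwu; case: (sep u).
have [//|[u Bu wvu]] := mult_basis_product Bw Bv.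
by have [wu vu] := nz_product_connected Bw Bv Bu wvu; case: (sep u).
Qed.

Lemma components_setD C C' :
  components B C -> components B C' -> C <> C' -> C' `<=` B `\` C.
Proof.
move=> hC hC' CC' v C'v; split; first exact: components_sub C'v.
by move=> Cv; apply: CC'; apply: (components_eq hC hC' Cv C'v); left.
Qed.

Lemma component_space_orthogonal C x y : components B C ->
  span C x -> span (B `\` C) y -> bracket x y = 0 /\ bracket y x = 0.
Proof.
move=> hC Cx Dy; split.
  apply: bracket_span0 Cx Dy => v w Cv Dw.
  by case: (component_orthogonal hC Cv Dw).
apply: bracket_span0 Dy Cx => w v Dw Cv.
by case: (component_orthogonal hC Cv Dw).
Qed.

Lemma orthogonal_components : orthogonal_family (components B) component_space.
Proof.
move=> C C' hC hC' CC' x y Cx Cy.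
case: (component_space_orthogonal hC Cx (y := y)) => //.
exact: span_mono (components_setD hC hC' CC') _ Cy.
Qed.

Lemma subspace_sum_components :
  [set: L] = subspace_sum (components B) component_space.
Proof.
apply/esym/seteqP; split=> // x _.
have : span B x by case: hB => -[_ <-].
apply: span_min.
  by apply: subspace_sum_subspace => C _; apply: span_subspace.
move=> v /components_cover[C hC Cv].
by apply: subspace_sum_term hC _; apply: mem_span.
Qed.

Lemma sum_other_components C : components B C ->
  subspace_sum (components B `\ C) component_space `<=` span (B `\` C).
Proof.
move=> hC; apply: subspace_sum_min; first exact: span_subspace.
move=> C' [hC' C'C]; apply: span_mono; apply: components_setD => //.
by move=> CC'; apply: C'C.
Qed.

Lemma component_rest_eq0 C x : components B C ->
  span C x -> span (B `\` C) x -> x = 0.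
Proof.
move=> hC; apply: (span_disjoint Bfree); first exact: components_sub.
  by move=> v [].
by apply/seteqP; split=> // v [? []].
Qed.

Lemma independent_components : is_independent (components B) component_space.
Proof.
move=> A f AC fC s0 C CA; have hC := AC C CA.
apply: (component_rest_eq0 hC (fC C CA)).
(* The term at C is minus the sum of the others, hence lies in the span of B minus C as well. *)
move: s0; rewrite (big_fsetD1 C) //= => /eqP; rewrite addr_eq0 => /eqP ->.
rewrite -scaleN1r; apply: subspaceZ; first exact: span_subspace.
apply: sum_other_components => //; exists (A `\ C)%fset, f; split=> //.
  by move=> i /=; rewrite in_fsetD1 => /andP[/eqP iC /AC].
by move=> i; rewrite in_fsetD1 => /andP[_ /fC].
Qed.

Lemma component_space_ideal C :
  components B C -> is_ideal [set: L] (component_space C).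
Proof.
have Ls x : span B x by case: hB => -[_ <-].
have Cs : is_subspace (span C) by exact: span_subspace.
move=> hC; split=> // x y Cx _.
have CB v w : C v -> B w -> span C (bracket v w) /\ span C (bracket w v).
  move=> Cv Bw.
  have mem z : z = 0 \/ (exists2 u, C u & nz_line u z) -> span C z.
    case=> [->|[u Cu /nz_line_line]]; first exact: subspace0.
    by apply: line_sub => //; apply: mem_span.
  by have [/mem ? /mem ?] := component_bracket hC Cv Bw.
split.
  by apply: (bracket_span Cs _ Cx (Ls y)) => v w Cv Bw; case: (CB v w).
by apply: (bracket_span Cs _ (Ls y) Cx) => w v Bw Cv; case: (CB v w).
Qed.

(** * The ideal of squares of a component, and its multiplicative basis *)

Lemma component_space_self_ideal C :
  components B C -> is_ideal (component_space C) (component_space C).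
Proof.
move=> /component_space_ideal[Cs _ Ci]; split=> // x y Cx _.
by case: (Ci x y Cx).
Qed.

(* Orthogonality makes the right-hand side an ideal of L, and kills the mixed *)
(* terms of [x, x], so that it contains every square.                         *)
Lemma leib_ideal_sub_sum : leib_ideal [set: L] `<=`
  subspace_sum (components B) (fun C => leib_ideal (component_space C)).
Proof.
pose W C := leib_ideal (component_space C).
have Wi C : components B C -> is_ideal (component_space C) (W C).
  by move=> hC; apply/is_ideal_leib_ideal/component_space_self_ideal.
have Ws C : components B C -> is_subspace (W C) by move=> /Wi[].
have Js := subspace_sum_subspace Ws.
apply: smallest_sub; last first.
  move=> _ [x _ <-]; have : [set: L] x by [].
  rewrite subspace_sum_components => -[A [f [AC fC ->]]].
  rewrite bracket_suml; apply: subspace_big => // C CA _.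
  rewrite bracket_sumr; apply: subspace_big => // C' C'A _.
  have [<-|/eqP CC'] := eqVneq C C'.
    by apply: (subspace_sum_term (AC C CA)); apply: leib_ideal_sq; apply: fC.
  have fC0 := orthogonal_components (AC C CA) (AC C' C'A) CC'.
  rewrite (fC0 _ _ (fC C CA) (fC C' C'A)).
  exact: subspace0.
split=> // x y Jx _.
(* Only the C-part a of y acts on z, since the remainder b is orthogonal to the span of C; and W C
   absorbs a. *)
have CJ C z : components B C -> W C z ->
    subspace_sum (components B) W (bracket z y) /\
    subspace_sum (components B) W (bracket y z).
  move=> hC Wz; have [_ WC Wb] := Wi C hC.
  have : [set: L] y by [].
  rewrite subspace_sum_components.
  move=> /(subspace_sum_split (W := component_space) (span_subspace C)).
  move=> [a [b [Ca /(sum_other_components hC) Db ->]]].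
  have [zb bz] := component_space_orthogonal hC (WC z Wz) Db.
  rewrite bracketDl bracketDr zb bz !addr0.
  by have [? ?] := Wb z a Wz Ca; split; apply: subspace_sum_term hC _.
split.
  apply: (subspace_sum_min (bracket_preiml_subspace y Js)) Jx => C hC z Wz.
  by case: (CJ C z hC Wz).
apply: (subspace_sum_min (bracket_preimr_subspace y Js)) Jx => C hC z Wz.
by case: (CJ C z hC Wz).
Qed.

(** The right-hand side is an ideal of the component containing its squares. Conversely, split x as
    a + b with a in the ideal of squares of C and b in the sum of the others: b = x - a lies in the
    span of C and in that of B minus C, so b = 0. *)
Lemma leib_ideal_component C : components B C ->
  leib_ideal (component_space C) = leib_ideal [set: L] `&` component_space C.
Proof.
move=> hC; have Ci := component_space_self_ideal hC.
have [Is IC _] := is_ideal_leib_ideal Ci.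
have [Ts _ Tb] := is_ideal_leib_ideal is_ideal_setT.
have [Cs _ Cb] := Ci.
apply/seteqP; split=> [|x [/leib_ideal_sub_sum Jx Cx]].
  apply: smallest_sub; last first.
    by move=> _ [x Cx <-]; split; [apply: leib_ideal_sq|case: (Cb x x Cx Cx)].
  split=> [|x []//|x y [Tx Cx] Cy].
    apply/is_subspaceP; split=> [|a x y [Tx Cx] [Ty Cy]].
      by split; apply: subspace0.
    by split; [apply: (subspaceD Ts (subspaceZ a Ts Tx))
              |apply: (subspaceD Cs (subspaceZ a Cs Cx))].
  by have [? ?] := Tb x y Tx I; have [? ?] := Cb x y Cx Cy.
pose W D := leib_ideal (component_space D).
have [a [b [Ia Jb xab]]] := subspace_sum_split (W := W) Is Jx.
suff b0 : b = 0 by rewrite xab b0 addr0.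
apply: (component_rest_eq0 hC).
  rewrite -[b](addKr a) -xab addrC.
  by apply: subspaceB => //; apply: IC.
apply: sum_other_components => //; apply: subspace_sum_mono Jb => // C' [hC' _].
by have [_ ] := is_ideal_leib_ideal (component_space_self_ideal hC').
Qed.

Lemma component_multiplicative_basis C : components B C ->
  is_multiplicative_basis (component_space C) C.
Proof.
move=> hC; have CB := components_sub hC.
have freeW D : D `<=` B -> is_free D.
  by move=> DB A c AD; apply: Bfree => v /AD /DB.
split; first by split; first exact: freeW.
case: hB => _ [V [BI [BV [_ [BE BIV] [[_ IE] _] hIV hVV]]]].
have BIB : BI `<=` B by rewrite BE => v; left.
have BVB : BV `<=` B by rewrite BE => v; right.
have CE : C = (BI `&` C) `|` (BV `&` C).
  by rewrite -setIUl -BE setIidr.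
have dis : (BI `&` C) `&` (BV `&` C) = set0 by rewrite setIACA BIV set0I.
have ICE : leib_ideal (component_space C) = span (BI `&` C).
  by rewrite leib_ideal_component // IE; apply: span_setI Bfree _ _.
have CIB : BI `&` C `<=` B by move=> v [/BIB].
have CVB : BV `&` C `<=` B by move=> v [/BVB].
(* The basis element supplied by [hIV] or [hVV] can fall outside C only when the product is zero,
   and a zero product lies on every line. *)
have prC v w u : C v -> B w -> B u ->
  line u (bracket v w) -> bracket v w = 0 \/ C u.
  move=> Cv Bw Bu /nz_lineP[->|vwu]; [by left|right].
  have [vu _] := nz_product_connected (CB v Cv) Bw Bu vwu.
  exact: components_connected vu.
exists (span (BV `&` C)), (BI `&` C), (BV `&` C); split=> //.
- rewrite ICE; split; first exact: span_subspace.
    by rewrite -span_setU -CE.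
  apply/seteqP; split=> [x [Ix Vx]|_ ->].
    exact: (span_disjoint Bfree CIB CVB dis Ix Vx).
  by split; apply: subspace0; apply: span_subspace.
- by rewrite ICE; split; split=> //; apply: freeW.
- move=> e u [Ie Ce] [Vu Cu]; have [e' Ie' eu] := hIV e u Ie Vu.
  have [eu0|Ce'] := prC e u e' Ce (CB u Cu) (BIB e' Ie') eu.
    by exists e => //; exists 0; rewrite ?scale0r.
  by exists e'.
- move=> u u' [Vu Cu] [Vu' Cu'].
  have [[w Vw uw]|[e Ie ue]] := hVV u u' Vu Vu'.
    have [uu0|Cw] := prC u u' w Cu (CB u' Cu') (BVB w Vw) uw.
      by left; exists u => //; exists 0; rewrite ?scale0r.
    by left; exists w.
  (* A zero product is moved to the [BV] alternative with witness u, because C may contain no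
     element of [BI]. *)
  have [uu0|Ce] := prC u u' e Cu (CB u' Cu') (BIB e Ie) ue.
    by left; exists u => //; exists 0; rewrite ?scale0r.
  by right; exists e.
Qed.

End MultiplicativeBasis.

End Brackets.

Theorem theorem2p1 (F : fieldType) (L : leibnizAlgType F) (B : set L)
    (hB : is_multiplicative_basis [set: L] B) :
  [/\ is_direct_sum [set: L] (components B) component_space,
      orthogonal_family (components B) component_space
    & forall C : set L, components B C ->
        [/\ is_direct_sum (component_space C) C line,
            is_ideal [set: L] (component_space C)
          & is_multiplicative_basis (component_space C) C]].
Proof.
split.
- by split; [exact: subspace_sum_components|exact: independent_components].
- exact: orthogonal_components.
- move=> C hC; have Cb := component_multiplicative_basis hB hC; split=> //.
    by split=> //; apply: free_independent; case: Cb => -[].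
  exact: component_space_ideal hC.
Qed.
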